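(* Every Prüfer ring is perinormal.
   Context: All rings are commutative with unity. For a ring $A$, $\mathrm{Reg}(A)$ is the set of regular elements (non-zero-divisors) of $A$, and the total quotient ring $K$ of $A$ is the fraction ring of $A$ with denominators in $\mathrm{Reg}(A)$. An ideal of $A$ is regular if it contains a regular element. An overring of $A$ is a ring $B$ with $A\subseteq B\subseteq K$. A ring extension $A\subseteq B$ satisfies going down if, whenever $P_1\subseteq P_2$ are prime ideals of $A$ and $Q_2$ is a prime ideal of $B$ with $Q_2\cap A=P_2$, there is a prime ideal $Q_1\subseteq Q_2$ of $B$ with $Q_1\cap A=P_1$. A GD-overring of $A$ is an overring $B$ of $A$ such that $A\subseteq B$ satisfies going down. A ring $A$ is perinormal if every GD-overring of $A$ is flat as an $A$-module. A regular ideal $I$ of $A$ is invertible if $II^{-1}=A$, where $I^{-1}=\{x\in K\mid xI\subseteq A\}$. A ring $A$ is a Prüfer ring if every finitely generated regular ideal of $A$ is invertible. *)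

(* Defs.v *)
From HB Require Import structures.
From mathcomp Require Import all_boot all_algebra.
From mathcomp Require Import generic_quotient ring_quotient.
From mathcomp Require Import boolp.
From mathcomp Require Import freeg ring.

Set Implicit Arguments.
Unset Strict Implicit.
Unset Printing Implicit Defensive.

Import GRing.Theory.
Local Open Scope ring_scope.
Local Open Scope quotient_scope.

(* Rings are commutative with unity, and may be zero ([comPzRingType]).
   Subsets of a ring are boolean predicates; `[< P >] is the truth value of P,
   so this is no restriction classically. *)

Section Ideals.
Variable A : comPzRingType.
Implicit Types I P : {pred A}.

(* [GRing.lreg s] says that multiplication by s is injective, i.e., that s is
   not a zero-divisor. *)
Definition regular_ideal I := exists2 s, s \in I & GRing.lreg s.

Definition is_ideal I := submod_closed (I : {pred A^o}).

Definition prime_ideal P :=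
  [/\ is_ideal P, 1 \notin P
    & forall u v, u * v \in P -> (u \in P) || (v \in P)].

Definition finitely_generated I :=
  exists s : seq A, forall x,
    x \in I <-> exists c : 'I_(size s) -> A, x = \sum_i c i * s`_i.

End Ideals.

Section TotalQuotientRing.
Variable A : comPzRingType.

Inductive qratio :=
  QRatio { qratio_pair :> A * A; _ : `[< GRing.lreg qratio_pair.2 >] }.

HB.instance Definition _ := [isSub for qratio_pair].
HB.instance Definition _ := [Choice of qratio by <:].

Implicit Types x y z : qratio.
Local Notation num x := (qratio_pair x).1.
Local Notation den x := (qratio_pair x).2.

Lemma den_reg x : GRing.lreg (den x).
Proof. by case: x => p /= /asboolP. Qed.

Lemma lreg_asbool1 : `[< GRing.lreg (1 : A) >].
Proof. exact/asboolP/lreg1. Qed.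

Lemma den_regM x y : `[< GRing.lreg (den x * den y) >].
Proof. by apply/asboolP/lregM; apply: den_reg. Qed.

Definition equivq x y := num x * den y == den x * num y.

Lemma equivq_refl : reflexive equivq.
Proof. by move=> x; rewrite /equivq mulrC. Qed.

Lemma equivq_sym : symmetric equivq.
Proof. by move=> x y; rewrite /equivq eq_sym; congr (_ == _); rewrite mulrC. Qed.

Lemma equivq_trans : transitive equivq.
Proof.
move=> y x z; rewrite /equivq => /eqP xy /eqP yz; apply/eqP.
by apply: (@den_reg y); rewrite mulrCA mulrA xy -mulrA yz mulrCA.
Qed.

Canonical equivq_equiv := EquivRel equivq equivq_refl equivq_sym equivq_trans.

Definition totfrac := {eq_quot equivq}.

HB.instance Definition _ : EqQuotient _ equivq totfrac := EqQuotient.on totfrac.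
HB.instance Definition _ := Choice.on totfrac.

Definition qratio_of (a : A) : qratio := @QRatio (a, 1) lreg_asbool1.
Definition addq x y : qratio :=
  @QRatio (num x * den y + num y * den x, den x * den y) (den_regM x y).
Definition oppq x : qratio := @QRatio (- num x, den x) (valP x).
Definition mulq x y : qratio :=
  @QRatio (num x * num y, den x * den y) (den_regM x y).

Definition totfrac_of := lift_embed totfrac qratio_of.
Canonical totfrac_of_pi_morph := PiEmbed totfrac_of.

Definition totfrac_add := lift_op2 totfrac addq.
Definition totfrac_opp := lift_op1 totfrac oppq.
Definition totfrac_mul := lift_op2 totfrac mulq.

Lemma equivq_repr x :
  num x * den (repr (\pi_totfrac x)) = den x * num (repr (\pi_totfrac x)).
Proof.
apply/eqP; change (equivq x (repr (\pi_totfrac x))).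
by rewrite -eqmodE reprK.
Qed.

Lemma pi_totfrac_add : {morph \pi_totfrac : x y / addq x y >-> totfrac_add x y}.
Proof.
move=> x y; unlock totfrac_add; apply/eqmodP; rewrite /= /equivq /=; apply/eqP.
have := equivq_repr x; have := equivq_repr y.
set y' := repr (\pi_totfrac y); set x' := repr (\pi_totfrac x) => Hy Hx.
transitivity (num x * den x' * (den y * den y') +
              num y * den y' * (den x * den x')); first by ring.
by rewrite Hx Hy; ring.
Qed.
Canonical pi_totfrac_add_morph := PiMorph2 pi_totfrac_add.

Lemma pi_totfrac_opp : {morph \pi_totfrac : x / oppq x >-> totfrac_opp x}.
Proof.
move=> x; unlock totfrac_opp; apply/eqmodP; rewrite /= /equivq /=.
by rewrite mulNr mulrN equivq_repr.
Qed.
Canonical pi_totfrac_opp_morph := PiMorph1 pi_totfrac_opp.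

Lemma pi_totfrac_mul : {morph \pi_totfrac : x y / mulq x y >-> totfrac_mul x y}.
Proof.
move=> x y; unlock totfrac_mul; apply/eqmodP; rewrite /= /equivq /=.
by rewrite mulrACA !equivq_repr mulrACA.
Qed.
Canonical pi_totfrac_mul_morph := PiMorph2 pi_totfrac_mul.

Lemma totfrac_addA : associative totfrac_add.
Proof.
elim/quotW=> x; elim/quotW=> y; elim/quotW=> z; rewrite !piE.
congr (\pi_totfrac _); apply: val_inj; rewrite /= !mulrDl !mulrA !addrA.
by rewrite [num y * _ * _]mulrAC [num z * _ * _]mulrAC.
Qed.

Lemma totfrac_addC : commutative totfrac_add.
Proof.
elim/quotW=> x; elim/quotW=> y; rewrite !piE.
by congr (\pi_totfrac _); apply: val_inj; rewrite /= addrC [den x * _]mulrC.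
Qed.

Lemma totfrac_add0 : left_id (totfrac_of 0) totfrac_add.
Proof.
elim/quotW=> x; rewrite !piE; congr (\pi_totfrac _); apply: val_inj => /=.
by rewrite mul0r mul1r mulr1 add0r; case: (qratio_pair x).
Qed.

Lemma totfrac_addN : left_inverse (totfrac_of 0) totfrac_opp totfrac_add.
Proof.
elim/quotW=> x; rewrite !piE; apply/eqmodP.
by rewrite /= /equivq /= mulNr addNr mul0r mulr0.
Qed.

HB.instance Definition _ := GRing.isZmodule.Build totfrac
  totfrac_addA totfrac_addC totfrac_add0 totfrac_addN.

Lemma totfrac_mulA : associative totfrac_mul.
Proof.
elim/quotW=> x; elim/quotW=> y; elim/quotW=> z; rewrite !piE.
by congr (\pi_totfrac _); apply: val_inj; rewrite /= !mulrA.
Qed.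

Lemma totfrac_mulC : commutative totfrac_mul.
Proof.
elim/quotW=> x; elim/quotW=> y; rewrite !piE.
by congr (\pi_totfrac _); apply: val_inj; rewrite /= [num x * _]mulrC [den x * _]mulrC.
Qed.

Lemma totfrac_mul1 : left_id (totfrac_of 1) totfrac_mul.
Proof.
elim/quotW=> x; rewrite !piE; congr (\pi_totfrac _); apply: val_inj => /=.
by rewrite !mul1r; case: (qratio_pair x).
Qed.

Lemma totfrac_mulDl : left_distributive totfrac_mul totfrac_add.
Proof.
elim/quotW=> x; elim/quotW=> y; elim/quotW=> z; rewrite !piE; apply/eqmodP.
rewrite /= /equivq /=; set a := num x; set b := num y; set c := num z.
set d := den x; set e := den y; set f := den z; apply/eqP.
rewrite !(mulrDl, mulrDr) !mulrA.
ring.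
Qed.

HB.instance Definition _ := GRing.Zmodule_isComPzRing.Build totfrac
  totfrac_mulA totfrac_mulC totfrac_mul1 totfrac_mulDl.

Lemma totfrac_of_zmod_morphism : zmod_morphism totfrac_of.
Proof.
move=> a b; unlock totfrac_of.
rewrite -[X in _ = _ + X]pi_totfrac_opp -[RHS]pi_totfrac_add.
by congr (\pi_totfrac _); apply: val_inj; rewrite /= !mulr1.
Qed.

Lemma totfrac_of_monoid_morphism : monoid_morphism totfrac_of.
Proof.
split=> // a b; unlock totfrac_of; rewrite -[RHS]pi_totfrac_mul.
by congr (\pi_totfrac _); apply: val_inj; rewrite /= mulr1.
Qed.

HB.instance Definition _ :=
  GRing.isZmodMorphism.Build A totfrac totfrac_of totfrac_of_zmod_morphism.
HB.instance Definition _ :=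
  GRing.isMonoidMorphism.Build A totfrac totfrac_of totfrac_of_monoid_morphism.

Lemma totfrac_of_inj : injective totfrac_of.
Proof.
move=> a b; unlock totfrac_of => /eqmodP.
by rewrite /= /equivq /= mulr1 mul1r => /eqP.
Qed.

Lemma totfrac_of_unit s :
  GRing.lreg s -> exists u : totfrac, totfrac_of s * u = 1.
Proof.
move=> sreg; exists (\pi_totfrac (@QRatio (1, s) (asboolT sreg))).
transitivity (totfrac_of 1) => //; unlock totfrac_of.
rewrite -[LHS]pi_totfrac_mul; apply/eqmodP.
by rewrite /= /equivq /= !mulr1 mul1r.
Qed.

Lemma totfrac_fracP (x : totfrac) :
  exists a s, GRing.lreg s /\ x * totfrac_of s = totfrac_of a.
Proof.
elim/quotW: x => x; exists (num x), (den x); split; first exact: den_reg.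
unlock totfrac_of; rewrite -[LHS]pi_totfrac_mul; apply/eqmodP.
by rewrite /= /equivq /= !mulr1 mulrC.
Qed.

End TotalQuotientRing.

Arguments totfrac_of {A}.

Section Prufer.
Variable A : comPzRingType.
Local Notation K := (totfrac A).
Implicit Types I : {pred A}.

Definition in_base : {pred K} := fun x => `[< exists a : A, x = totfrac_of a >].

Definition ideal_inv I : {pred K} :=
  fun x => `[< forall a, a \in I -> x * totfrac_of a \in in_base >].

Definition ideal_mul I (J : {pred K}) : {pred K} :=
  fun y => `[< exists s : seq (A * K),
    {in s, forall p, p.1 \in I /\ p.2 \in J} /\
    y = \sum_(p <- s) totfrac_of p.1 * p.2 >].

Definition invertible_ideal I := ideal_mul I (ideal_inv I) =i in_base.

Definition prufer_ring :=
  forall I, is_ideal I -> finitely_generated I -> regular_ideal I ->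
    invertible_ideal I.

Record overring := Overring {
  overring_pred :> {pred K};
  overring_closed : subring_closed overring_pred;
  overring_base : {subset in_base <= overring_pred} }.

HB.instance Definition _ (B : overring) :=
  GRing.isSubringClosed.Build K (overring_pred B) (@overring_closed B).

End Prufer.

Section OverringType.
Variables (A : comPzRingType) (B : overring A).
Local Notation K := (totfrac A).

Inductive overring_type :=
  OverringElt { overring_val :> K; _ : overring_val \in overring_pred B }.

HB.instance Definition _ := [isSub for overring_val].
HB.instance Definition _ := [Choice of overring_type by <:].
HB.instance Definition _ := GRing.SubChoice_isSubComPzRing.Build
  K (mem (overring_pred B)) overring_type (overring_closed B).

Lemma totfrac_of_overring (a : A) : totfrac_of a \in overring_pred B.
Proof. by apply: overring_base; apply/asboolP; exists a. Qed.

Definition overring_incl (a : A) : overring_type :=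
  OverringElt (totfrac_of_overring a).

Lemma overring_incl_zmod_morphism : zmod_morphism overring_incl.
Proof. by move=> a b; apply: val_inj; rewrite /= !rmorphB. Qed.

Lemma overring_incl_monoid_morphism : monoid_morphism overring_incl.
Proof.
by split=> [|a b]; apply: val_inj; rewrite ?rmorphM /= ?rmorphM ?rmorph1.
Qed.

HB.instance Definition _ := GRing.isZmodMorphism.Build A overring_type
  overring_incl overring_incl_zmod_morphism.
HB.instance Definition _ := GRing.isMonoidMorphism.Build A overring_type
  overring_incl overring_incl_monoid_morphism.

Definition overring_scale (a : A) (x : overring_type) := overring_incl a * x.

Fact overring_scaleA a b x :
  overring_scale a (overring_scale b x) = overring_scale (a * b) x.
Proof. by rewrite /overring_scale rmorphM mulrA. Qed.
Fact overring_scale1 : left_id 1 overring_scale.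
Proof. by move=> x; rewrite /overring_scale rmorph1 mul1r. Qed.
Fact overring_scaleDr : right_distributive overring_scale +%R.
Proof. by move=> a x y; rewrite /overring_scale mulrDr. Qed.
Fact overring_scaleDl x : {morph overring_scale^~ x : a b / a + b}.
Proof. by move=> a b; rewrite /overring_scale rmorphD mulrDl. Qed.

HB.instance Definition _ := GRing.Zmodule_isLmodule.Build A overring_type
  overring_scaleA overring_scale1 overring_scaleDr overring_scaleDl.

End OverringType.

Definition going_down (A B : comPzRingType) (i : {rmorphism A -> B}) :=
  forall (P1 P2 : {pred A}) (Q2 : {pred B}),
    prime_ideal P1 -> prime_ideal P2 -> prime_ideal Q2 ->
    {subset P1 <= P2} -> [preim i of Q2] =i P2 ->
  exists Q1 : {pred B},
    [/\ prime_ideal Q1, {subset Q1 <= Q2} & [preim i of Q1] =i P1].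

Section Tensor.
Variables (A : comPzRingType) (M N : lmodType A).

(* M (x) N is the free abelian group on M * N modulo the subgroup generated by
   the relations of A-balanced biadditivity. Its A-module
   structure is omitted, as injectivity of f (x) id_N does not involve it. *)
Local Notation F := {freeg (M * N)%type / int}.
Local Notation gen m n := (<< (m, n) >> : F).

Variant tensor_relation : F -> Prop :=
  | TensorDl m m' n : tensor_relation (gen (m + m') n - gen m n - gen m' n)
  | TensorDr m n n' : tensor_relation (gen m (n + n') - gen m n - gen m n')
  | TensorZ a m n : tensor_relation (gen (a *: m) n - gen m (a *: n)).

Definition tensor_null : {pred F} := fun x =>
  `[< forall S : {pred F}, zmod_closed S ->
      (forall r, tensor_relation r -> r \in S) -> x \in S >].

Lemma tensor_null_rel r : tensor_relation r -> r \in tensor_null.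
Proof. by move=> rP; apply/asboolP => S _; apply. Qed.

Lemma tensor_null_closed : zmod_closed tensor_null.
Proof.
split=> [|x y /asboolP xN /asboolP yN]; apply/asboolP => S Sz Sr.
  by case: Sz.
by case: (Sz) => _; apply; [apply: xN | apply: yN].
Qed.

HB.instance Definition _ :=
  GRing.isZmodClosed.Build F tensor_null tensor_null_closed.

Definition tensor := Quotient.quot tensor_null.
HB.instance Definition _ := GRing.Zmodule.on tensor.

Definition tensor_pi (x : F) : tensor := \pi_(Quotient.quot tensor_null) x.
Definition pure_tensor m n : tensor := tensor_pi (gen m n).

Lemma tensor_pi_eq x y : tensor_pi x = tensor_pi y <-> x - y \in tensor_null.
Proof.
by rewrite Quotient.idealrBE; split=> [H|/eqP //]; apply/eqP.
Qed.

Lemma tensor_pi_surj t : exists x, t = tensor_pi x.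
Proof. by exists (repr t); rewrite /tensor_pi reprK. Qed.

Lemma tensor_pi_zmod_morphism : zmod_morphism tensor_pi.
Proof. by move=> x y; rewrite /tensor_pi raddfB. Qed.

HB.instance Definition _ :=
  GRing.isZmodMorphism.Build F tensor tensor_pi tensor_pi_zmod_morphism.

Lemma pure_tensorDl m m' n :
  pure_tensor (m + m') n = pure_tensor m n + pure_tensor m' n.
Proof.
rewrite /pure_tensor -raddfD; apply/tensor_pi_eq; rewrite opprD addrA.
exact/tensor_null_rel/TensorDl.
Qed.

Lemma pure_tensorDr m n n' :
  pure_tensor m (n + n') = pure_tensor m n + pure_tensor m n'.
Proof.
rewrite /pure_tensor -raddfD; apply/tensor_pi_eq; rewrite opprD addrA.
exact/tensor_null_rel/TensorDr.
Qed.

Lemma pure_tensorZ a m n : pure_tensor (a *: m) n = pure_tensor m (a *: n).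
Proof. exact/tensor_pi_eq/tensor_null_rel/TensorZ. Qed.

End Tensor.

Arguments tensor_null {A} M N.
Arguments pure_tensor {A M N}.

Section TensorMap.
Variables (A : comPzRingType) (M M' N : lmodType A) (f : {linear M -> M'}).

Definition free_map : {freeg (M * N)%type / int} -> {freeg (M' * N)%type / int} :=
  fglift (fun p => << (f p.1, p.2) >>).

Lemma free_map_zmod_morphism : zmod_morphism free_map.
Proof. exact: lift_is_additive. Qed.

HB.instance Definition _ := GRing.isZmodMorphism.Build
  {freeg (M * N)%type / int} {freeg (M' * N)%type / int}
  free_map free_map_zmod_morphism.

Lemma free_map_gen m n : free_map << (m, n) >> = << (f m, n) >>.
Proof. by rewrite /free_map liftU scale1r. Qed.

(* f (x) id_N *)
Definition tensor_map (t : tensor M N) : tensor M' N :=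
  tensor_pi (free_map (repr t)).

Lemma free_map_null x : x \in tensor_null M N -> free_map x \in tensor_null M' N.
Proof.
move=> /asboolP xN; pose S := [preim free_map of tensor_null M' N].
have SE y : (y \in S) = (free_map y \in tensor_null M' N) by [].
rewrite -SE; apply: xN => [|r [m m' n|m n n'|a m n]].
- split=> [|y z]; first by rewrite SE raddf0 rpred0.
  by rewrite !SE raddfB => yN zN; rewrite rpredB.
- by rewrite SE !raddfB /= !free_map_gen linearD; exact/tensor_null_rel/TensorDl.
- by rewrite SE !raddfB /= !free_map_gen; exact/tensor_null_rel/TensorDr.
- by rewrite SE !raddfB /= !free_map_gen linearZ; exact/tensor_null_rel/TensorZ.
Qed.

Lemma tensor_map_pi x : tensor_map (tensor_pi x) = tensor_pi (free_map x).
Proof.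
apply/tensor_pi_eq; rewrite -raddfB; apply: free_map_null.
by apply/tensor_pi_eq; rewrite /tensor_pi reprK.
Qed.

Lemma tensor_map_zmod_morphism : zmod_morphism tensor_map.
Proof.
move=> t u; have [x ->] := tensor_pi_surj t; have [y ->] := tensor_pi_surj u.
by rewrite -raddfB !tensor_map_pi !raddfB.
Qed.

HB.instance Definition _ := GRing.isZmodMorphism.Build
  (tensor M N) (tensor M' N) tensor_map tensor_map_zmod_morphism.

Lemma tensor_map_pure m n : tensor_map (pure_tensor m n) = pure_tensor (f m) n.
Proof. by rewrite /pure_tensor tensor_map_pi free_map_gen. Qed.

End TensorMap.

Arguments tensor_map {A M M'} N f.

Definition flat (A : comPzRingType) (N : lmodType A) :=
  forall (M M' : lmodType A) (f : {linear M -> M'}),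
    injective f -> injective (tensor_map N f).

Definition perinormal (A : comPzRingType) :=
  forall B : overring A,
    going_down (@overring_incl A B) -> flat (overring_type B).

(* Main.v *)
(* Every overring B of a Pruefer ring A is flat. For x = a / s in B,
   invertibility of the ideal (a, s) shows that the ideal of the d in A with
   d x in A generates B. Given such denominators, an element of M (x) B
   vanishes iff all d in some J with J B = B clear its denominators to 0 in M,
   and this criterion is reflected by an injection M -> M'. *)
Require Import Defs.
From HB Require Import structures.
From mathcomp Require Import all_boot all_algebra.
From mathcomp Require Import boolp freeg ring.

Set Implicit Arguments.
Unset Strict Implicit.
Unset Printing Implicit Defensive.

Import GRing.Theory.
Local Open Scope ring_scope.

(** * Free abelian groups and pure tensors *)

Lemma freeg_zmod_ind (T : choiceType) (P : {freeg T / int} -> Prop) :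
  P 0 -> (forall x y, P x -> P y -> P (x - y)) -> (forall t, P << t >>) ->
  forall x, P x.
Proof.
move=> P0 PB PU x.
have PN y : P y -> P (- y) by rewrite -sub0r; apply: PB.
have PD y z : P y -> P z -> P (y + z).
  by move=> Py /PN; rewrite -{2}[z]opprK; apply: PB.
have PM y n : P y -> P (y *+ n).
  by move=> Py; elim: n => [|n IH]; rewrite ?mulr0n // mulrS; apply: PD.
rewrite -[x]freeg_sumE; elim/big_ind: _ => // t _.
have -> : << coeff t x *g t >> = << t >> *~ coeff t x :> {freeg T / int}.
  by rewrite freeg_mulz intz.
by case: (coeff t x) => n; [apply: PM | apply/PN/PM]; apply: PU.
Qed.

Section PureTensor.
Variables (A : comPzRingType) (M N : lmodType A).
Implicit Types (m : M) (n : N).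

Lemma pure_tensorBl m m' n :
  pure_tensor (m - m') n = pure_tensor m n - pure_tensor m' n.
Proof. by apply: (addIr (pure_tensor m' n)); rewrite -pure_tensorDl !subrK. Qed.

Lemma pure_tensor0l n : pure_tensor (0 : M) n = 0.
Proof. by rewrite -(subrr 0) pure_tensorBl subrr. Qed.

Lemma pure_tensor0r m : pure_tensor m (0 : N) = 0.
Proof. by rewrite -(scale0r 0) -pure_tensorZ scale0r pure_tensor0l. Qed.

Lemma pure_tensor_sumr m (I : Type) (r : seq I) (F : I -> N) :
  pure_tensor m (\sum_(i <- r) F i) = \sum_(i <- r) pure_tensor m (F i).
Proof. exact: (big_morph _ (pure_tensorDr m) (pure_tensor0r m)). Qed.

End PureTensor.

(** * Denominators in A of the elements of an overring *)

Section Denominators.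
Variables (A : comPzRingType) (B : overring A).
Local Notation E := (overring_type B).
Implicit Types (J : {pred A}) (x y : E).

Lemma overring_incl_inj : injective (@overring_incl A B).
Proof. by move=> a b /(congr1 val)/totfrac_of_inj. Qed.

Lemma overring_scaleE a x : a *: x = overring_incl B a * x.
Proof. by []. Qed.

(** This is J B = B. Stability under multiplication by A makes the condition pass to
    intersections. *)
Definition generates_unit J :=
  (forall a d, d \in J -> a * d \in J) /\
  exists2 s : seq (A * E), {in s, forall p, p.1 \in J} &
    \sum_(p <- s) p.1 *: p.2 = 1.

Lemma generates_unitT : generates_unit xpredT.
Proof.
by split=> //; exists [:: (1, 1)] => //; rewrite big_seq1 scale1r.
Qed.

(** The product of the two expressions of 1 has coefficients that are products from [J1] and [J2],
    hence lie in both. *)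
Lemma generates_unitI J1 J2 :
  generates_unit J1 -> generates_unit J2 -> generates_unit [predI J1 & J2].
Proof.
move=> [J1M [s1 s1J E1]] [J2M [s2 s2J E2]]; split=> [a d|].
  by rewrite !inE => /andP[d1 d2]; rewrite !(J1M, J2M).
exists [seq (p.1 * q.1, p.2 * q.2) | p <- s1, q <- s2].
  move=> _ /allpairsP[[p q] [/= ps qs ->]]; rewrite !inE /=.
  by rewrite J2M ?s2J // mulrC J1M ?s1J.
rewrite big_allpairs_dep /= -[RHS]mulr1 -{1}E1 -E2 mulr_suml.
apply: eq_bigr => p _; rewrite mulr_sumr; apply: eq_bigr => q _.
by rewrite !overring_scaleE rmorphM mulrACA.
Qed.

(** The conductor ideal (A : x). *)
Definition denominators x : {pred A} :=
  fun a => `[< exists b, a *: x = overring_incl B b >].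

Lemma denominatorsM x a d : d \in denominators x -> a * d \in denominators x.
Proof.
move=> /asboolP[b xb]; apply/asboolP; exists (a * b).
by rewrite -scalerA xb overring_scaleE rmorphM.
Qed.

(* 0 if x is not in the image of A *)
Definition numerator x : A :=
  if pselect (exists a, x = overring_incl B a) is left H then projT1 (cid H)
  else 0.

Lemma numeratorK a : numerator (overring_incl B a) = a.
Proof.
rewrite /numerator; case: pselect => [H|[]]; last by exists a.
by case: cid => b /= /overring_incl_inj.
Qed.

Lemma denominatorsP x d :
  reflect (overring_incl B (numerator (d *: x)) = d *: x) (d \in denominators x).
Proof.
apply: (iffP (asboolP _)) => [[b ->]|<-]; first by rewrite numeratorK.
by exists (numerator (d *: x)).
Qed.

Lemma prufer_denominators x :
  prufer_ring A -> generates_unit (denominators x).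
Proof.
move=> prA; split; first exact: denominatorsM.
have [a [s [sreg xs]]] := totfrac_fracP (overring_val x).
pose I : {pred A} := fun z => `[< exists c d, z = c * a + d * s >].
have IP z : reflect (exists c d, z = c * a + d * s) (z \in I) by apply: asboolP.
have aI : a \in I by apply/IP; exists 1, 0; ring.
have sI : s \in I by apply/IP; exists 0, 1; ring.
have idI : is_ideal I.
  split=> [|c u v /IP[c1 [d1 ->]] /IP[c2 [d2 ->]]]; apply/IP.
    by exists 0, 0; rewrite !mul0r addr0.
  exists (c * c1 + c2), (c * d1 + d2); rewrite /GRing.scale /=; ring.
have fgI : finitely_generated I.
  exists [:: a; s] => z; split=> [/IP[c [d ->]]|[c ->]].
    exists (fun i => if i == 0 :> nat then c else d).
    by rewrite !big_ord_recl big_ord0 /= addr0.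
  apply/IP; rewrite !big_ord_recl big_ord0 /= addr0.
  by eexists; eexists.
have invI := prA I idI fgI (ex_intro2 _ _ s sI sreg).
have : 1 \in in_base (A := A) by apply/asboolP; exists 1; rewrite rmorph1.
rewrite -invI => /asboolP[t [tI t1]].
(* The sum over [t] is converted term by term; no longer asking it to be 1 lets induction on [t] go
   through. *)
suff [r rd tr] : exists2 r : seq (A * E),
    {in r, forall p, p.1 \in denominators x} &
    val (\sum_(p <- r) p.1 *: p.2) = \sum_(p <- t) totfrac_of p.1 * p.2.
  by exists r => //; apply: val_inj; rewrite tr -t1.
elim: t tI {t1} => [|[z y] t IH] tI.
  by exists [::] => //; rewrite !big_nil.
have [p pt|r rd rt] := IH; first by apply: tI; rewrite inE pt orbT.
have [/= /IP[c [d ->]] /asboolP yI] := tI (z, y) (mem_head _ _).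
(* As y is in the inverse of I, e = y s and f = y a lie in A; x s = a then gives e x = f, so e is a
   denominator of x. *)
have /asboolP[e ye] := yI _ sI; have /asboolP[f yf] := yI _ aI.
have ex : totfrac_of e * overring_val x = totfrac_of f.
  by rewrite -ye -yf -xs; ring.
(* From a = x s, the term (c a + d s) y equals e (c x + d), and c x + d lies in B. *)
exists ((e, c *: x + overring_incl B d) :: r) => [p|].
  rewrite inE => /orP[/eqP->|/rd//].
  by apply/asboolP; exists f; apply: val_inj.
rewrite !big_cons raddfD /= rt; congr (_ + _).
transitivity (totfrac_of e * (totfrac_of c * overring_val x + totfrac_of d)).
  by rewrite mulrDr.
by rewrite -ye !rmorphD !rmorphM /= -xs; ring.
Qed.

End Denominators.

(** * Vanishing in a tensor product with an overring, and flatness *)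

Section Clearing.
Variables (A : comPzRingType) (B : overring A).
Local Notation E := (overring_type B).
Local Notation F M := {freeg (M * E)%type / int}.

Section Clear.
Variables (M : lmodType A) (d : A).

(* m (x) y |-> (d y) m, which makes sense when d y lies in A *)
Definition clear : F M -> M :=
  fglift (fun p => numerator (d *: p.2) *: p.1 : zmodule M).

Lemma clear_zmod_morphism : zmod_morphism clear.
Proof.
exact: (@lift_is_additive _ _ (zmodule M)
  (fun p : M * E => numerator (d *: p.2) *: p.1)).
Qed.

HB.instance Definition _ :=
  GRing.isZmodMorphism.Build (F M) M clear clear_zmod_morphism.

Lemma clearU m y : clear << (m, y) >> = numerator (d *: y) *: m.
Proof. by rewrite /clear liftU scale1r. Qed.

End Clear.

Lemma clear_free_map (M M' : lmodType A) (f : {linear M -> M'}) d (x : F M) :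
  clear d (free_map f x) = f (clear d x).
Proof.
elim/freeg_zmod_ind: x => [|x y IHx IHy|[m y]]; first by rewrite !raddf0.
  by rewrite !raddfB /= IHx IHy.
by rewrite free_map_gen !clearU linearZ.
Qed.

Hypothesis unit_denominators :
  forall y : E, generates_unit B (denominators y).

(** For a fixed d, [clear d] need not respect the relations, since [numerator] is additive only on
    the image of A. Common denominators of the elements of B in a relation do send it to 0, and
    intersecting the sets J handles differences. *)
Lemma null_clear (M : lmodType A) (x : F M) :
  x \in tensor_null M E ->
  exists2 J, generates_unit B J & {in J, forall d, clear d x = 0}.
Proof.
pose P := fun z : F M =>
  exists2 J, generates_unit B J & {in J, forall d, clear d z = 0}.
(* [tensor_null] is the least subgroup containing the relations, so it suffices that [P] defines
   such a subgroup. *)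
move=> /asboolP/(_ (fun z => `[< P z >])) xN; apply/asboolP; apply: xN.
  split=> [|y z /asboolP[J1 J1u y0] /asboolP[J2 J2u z0]]; apply/asboolP.
    by exists xpredT; [apply: generates_unitT | move=> d _; rewrite raddf0].
  eexists; first exact: generates_unitI J1u J2u.
  by move=> d /andP[d1 d2]; rewrite raddfB /= y0 // z0 // subr0.
move=> _ [m m' y|m y y'|a m y]; apply/asboolP.
- exists xpredT => [|d _]; first exact: generates_unitT.
  by rewrite !raddfB /= !clearU scalerDr -addrA -opprD subrr.
- eexists=> [|d /andP[dy dy']].
    exact: generates_unitI (unit_denominators y) (unit_denominators y').
  rewrite !raddfB /= !clearU scalerDr.
  rewrite -(denominatorsP _ _ dy) -(denominatorsP _ _ dy') -rmorphD.
  by rewrite !numeratorK scalerDl -addrA -opprD subrr.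
- exists (denominators y) => // d dy.
  rewrite raddfB /= !clearU !scalerA [d * a]mulrC -[(a * d) *: y]scalerA.
  rewrite -(denominatorsP _ _ dy) [a *: _]overring_scaleE -rmorphM.
  by rewrite !numeratorK [a * _]mulrC subrr.
Qed.

(** For a generator m (x) y, expand y as the sum of the (p.1 y) p.2 and move the coefficients p.1 y,
    which lie in A, across the tensor. Allowing every [s] over J lets a difference use one [s] for
    both terms. *)
Lemma tensor_pi_clear (M : lmodType A) (x : F M) :
  exists2 J, generates_unit B J &
    forall s : seq (A * E), {in s, forall p, p.1 \in J} ->
      \sum_(p <- s) p.1 *: p.2 = 1 ->
      tensor_pi x = \sum_(p <- s) pure_tensor (clear p.1 x) p.2.
Proof.
elim/freeg_zmod_ind: x => [|x y [J1 J1u xE] [J2 J2u yE]|[m y]].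
- exists xpredT => [|s _ _]; first exact: generates_unitT.
  rewrite raddf0 big1 // => p _.
  by rewrite raddf0 pure_tensor0l.
- eexists=> [|s sJ s1]; first exact: generates_unitI J1u J2u.
  rewrite raddfB /= (xE s) //; last by move=> p /sJ/andP[].
  rewrite (yE s) //; last by move=> p /sJ/andP[].
  rewrite -sumrB; apply: eq_bigr => p _.
  by rewrite raddfB /= pure_tensorBl.
exists (denominators y) => // s sJ s1.
rewrite -[LHS]/(pure_tensor m y) -[y in LHS]mul1r -s1 mulr_suml pure_tensor_sumr.
rewrite big_seq [RHS]big_seq; apply: eq_bigr => p /sJ/denominatorsP py.
rewrite clearU pure_tensorZ [in RHS]overring_scaleE py; congr pure_tensor.
by rewrite !overring_scaleE mulrAC.
Qed.

(** An expression of 1 over both J and the set from [tensor_pi_clear] turns x into a sum of pure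
    tensors with left factor 0. *)
Lemma clear0_null (M : lmodType A) (x : F M) J :
  generates_unit B J -> {in J, forall d, clear d x = 0} -> tensor_pi x = 0.
Proof.
move=> Ju x0; have [J' J'u xE] := tensor_pi_clear x.
have [_ [s sJ s1]] := generates_unitI Ju J'u.
rewrite (xE s) //; last by move=> p /sJ/andP[].
rewrite big_seq big1 // => p /sJ/andP[/x0-> _].
exact: pure_tensor0l.
Qed.

Lemma generates_unit_flat : flat E.
Proof.
move=> M M' f f_inj; apply: raddf_inj => t.
have [x ->] := tensor_pi_surj t; rewrite /= tensor_map_pi => fx0.
have /null_clear[J Ju fJ] : free_map f x \in tensor_null M' E.
  by rewrite -[free_map f x]subr0; apply/tensor_pi_eq; rewrite raddf0.
(* The J found for the image of x also works for x, as [clear d] commutes with the injection f. *)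
apply: (clear0_null Ju) => d /fJ; rewrite clear_free_map => fd0.
by apply: f_inj; rewrite raddf0.
Qed.

End Clearing.

Theorem proposition2 (A : comPzRingType) : prufer_ring A -> perinormal A.
Proof.
by move=> prA B _; apply: generates_unit_flat => y; apply: prufer_denominators.
Qed.
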